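(* Let $J\subseteq\Phi^+$ be column closed. Each right $U_J$-orbit on $\hat V_J$ contains exactly one template, and hence the templates classify the right orbits of $U_J$ acting on $\hat V_J$ (i.e. $[A]\mapsto\mathcal O_A^r=[A].U_J$ is a bijection from the set of templates in $\hat V_J$ onto the set of right $U_J$-orbits on $\hat V_J$).
   Context: $q$ is a prime power, $n\in\mathbb N$, $E$ the $n\times n$ identity matrix, $\Phi^+=\{(i,j)\mid 1\le i<j\le n\}$. $J\subseteq\Phi^+$ is column closed if $J=\{(i,j)\mid 1\le i<j\le n,\ j\in I\}$ for some $I\subseteq\{1,\ldots,n\}$. $V_J=\{A\in M_n(q)\mid A_{ij}=0\text{ for }(i,j)\notin J\}$ and $U_J=\{E+A\mid A\in V_J\}$, a group under matrix multiplication acting on $V_J$ by right multiplication. $\pi_J:M_n(q)\to V_J$ sets all entries at positions outside $J$ to $0$. Fix a nontrivial character $\theta:(\mathbb F_q,+)\to\mathbb C^*$; for $A\in V_J$, $[A]$ is the linear character of $(V_J,+)$ given by $[A](B)=\theta(\sum_{(i,j)\in J}A_{ij}B_{ij})$, and $\hat V_J=\{[A]\mid A\in V_J\}$ is the set of all linear characters. The right permutation action of $U_J$ on $\hat V_J$ is $([A].u)(B)=[A](Bu^{-1})$, equivalently $[A].u=[\pi_J(A(u^{-1})^t)]$. $[A]\in\hat V_J$ is called a (right) template if in $A$, to the left of the highest (topmost) nonzero entry of each nonzero column, all entries at positions in $J$ are zero. *)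

(* Defs.v *)
From HB Require Import structures.
From mathcomp Require Import all_boot all_order all_algebra.
From mathcomp Require Export complex.
From mathcomp Require Import boolp classical_sets functions reals.

Set Implicit Arguments.
Unset Strict Implicit.
Unset Printing Implicit Defensive.

Import GRing.Theory.
Local Open Scope ring_scope.

(* Rows and columns are indexed by 'I_n, i.e. from 0 instead of from 1. *)
Definition Phi_plus (n : nat) : {set 'I_n * 'I_n} :=
  [set ij : 'I_n * 'I_n | (ij.1 < ij.2)%N]%SET.

Definition column_closed (n : nat) (J : {set 'I_n * 'I_n}) : Prop :=
  exists I : {set 'I_n}, J = [set ij in Phi_plus n | ij.2 \in I]%SET.

Section PatternSpace.
Variables (F : finFieldType) (n : nat) (J : {set 'I_n * 'I_n}).

Definition supported : {pred 'M[F]_n} :=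
  [pred A : 'M[F]_n | [forall i, forall j, ((i, j) \notin J) ==> (A i j == 0)]].

Lemma supportedP (A : 'M[F]_n) :
  reflect (forall i j, (i, j) \notin J -> A i j = 0) (A \in supported).
Proof.
apply: (iffP idP) => [/forallP AJ i j ijJ | AJ].
  by have /forallP/(_ j)/implyP/(_ ijJ)/eqP := AJ i.
by apply/forallP => i; apply/forallP => j; apply/implyP => /AJ ->.
Qed.

Fact supported_zmod_closed : zmod_closed supported.
Proof.
split=> [|A B /supportedP AJ /supportedP BJ]; apply/supportedP => i j ijJ.
  by rewrite mxE.
by rewrite !mxE AJ ?BJ ?subr0.
Qed.

HB.instance Definition _ :=
  GRing.isZmodClosed.Build 'M[F]_n supported supported_zmod_closed.

Record V : predArgType := MkV { V_val :> 'M[F]_n; _ : V_val \in supported }.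

HB.instance Definition _ := [isSub of V for V_val].
HB.instance Definition _ := [Choice of V by <:].
HB.instance Definition _ := [SubChoice_isSubZmodule of V by <:].

Fact proj_supported (A : 'M[F]_n) :
  \matrix_(i, j) (if (i, j) \in J then A i j else 0) \in supported.
Proof. by apply/supportedP => i j /negPf ijJ; rewrite mxE ijJ. Qed.

Definition proj (A : 'M[F]_n) : V := MkV (proj_supported A).

Lemma proj_id (A : 'M[F]_n) : A \in supported -> V_val (proj A) = A.
Proof.
move=> /supportedP AJ; apply/matrixP => i j; rewrite mxE.
by case: ifPn => // /AJ ->.
Qed.

Definition U : set 'M[F]_n := [set 1%:M + V_val A | A in [set: V]]%classic.

(* For column closed J, V_J is stable under right multiplication by u^-1 for
   u in U_J; hence the projection in [char_act] below only serves to view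
   B u^-1 as an element of V_J. *)
Lemma proj_mulmx_invmx (B : V) (u : 'M[F]_n) :
  column_closed J -> U u -> V_val (proj (B *m invmx u)) = B *m invmx u.
Proof.
move=> [I defJ] [A _ <-]; apply: proj_id; set u1 := 1%:M + _.
have inJ i j : ((i, j) \in J) = (i < j)%N && (j \in I) by rewrite defJ !inE.
have /supportedP A0 := valP A; have /supportedP B0 := valP B.
rewrite /= in A0 B0.
have u1_unit : u1 \in unitmx.
  rewrite -unitmx_tr unitmxE det_trig.
    rewrite big1 ?unitr1 // => i _.
    by rewrite !mxE eqxx A0 ?addr0 // inJ ltnn.
  apply/is_trig_mxP => i j ltij.
  rewrite !mxE A0 ?inJ ?(ltn_geF (ltnW ltij)) ?addr0 //; last first.
    by rewrite ltnNge (ltnW ltij).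
  by case: eqP ltij => // ->; rewrite ltnn.
set D := B *m _; have DE : D = V_val B - D *m V_val A.
  by rewrite -[V_val B in RHS](mulmxKV u1_unit) -/D mulmxDr mulmx1 addrK.
have D0 m : forall i j : 'I_n, (j < m)%N -> (i, j) \notin J -> D i j = 0.
  elim: m => // m IHm i j lt_jm ijJ; rewrite DE mxE B0 // add0r mxE mxE.
  rewrite big1 ?oppr0 // => k _; have [kjJ|kjJ] := boolP ((k, j) \in J).
    move: kjJ ijJ; rewrite !inJ => /andP[ltkj ->]; rewrite andbT -leqNgt.
    move=> leji; rewrite IHm ?mul0r ?(leq_trans ltkj) // inJ.
    by rewrite ltnNge (leq_trans (ltnW ltkj)).
  by rewrite A0 ?mulr0.
by apply/supportedP => i j; apply: D0 (ltn_ord j).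
Qed.

End PatternSpace.

Arguments U F {n} J.

Definition linear_char (R : realType) (G : zmodType) (chi : G -> R[i]) : Prop :=
  (forall x, chi x != 0) /\ (forall x y, chi (x + y) = chi x * chi y).

Definition nontrivial_char (R : realType) (G : zmodType) (chi : G -> R[i]) :
    Prop :=
  linear_char chi /\ exists x, chi x != 1.

Section Characters.
Variables (R : realType) (F : finFieldType) (n : nat) (J : {set 'I_n * 'I_n}).

Definition hatV : set (V F J -> R[i]) := [set chi | linear_char chi]%classic.

(* [bracket theta A] is the linear character written [A] in the literature. *)
Definition bracket (theta : F -> R[i]) (A : V F J) : V F J -> R[i] :=
  fun B => theta (\sum_(ij in J) A ij.1 ij.2 * B ij.1 ij.2).

Definition char_act (chi : V F J -> R[i]) (u : 'M[F]_n) : V F J -> R[i] :=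
  fun B => chi (proj J (B *m invmx u)).

Definition right_orbit (chi : V F J -> R[i]) : set (V F J -> R[i]) :=
  [set char_act chi u | u in U F J]%classic.

Definition right_orbits : set (set (V F J -> R[i])) :=
  [set right_orbit chi | chi in hatV]%classic.

Definition topmost_nonzero (A : 'M[F]_n) (i j : 'I_n) : Prop :=
  A i j != 0 /\ forall k : 'I_n, (k < i)%N -> A k j = 0.

Definition is_template (A : V F J) : Prop :=
  forall i j, topmost_nonzero A i j ->
  forall l : 'I_n, (l < j)%N -> (i, l) \in J -> A i l = 0.

Definition templates (theta : F -> R[i]) : set (V F J -> R[i]) :=
  [set bracket theta A | A in [set A | is_template A]]%classic.

End Characters.

Arguments hatV R F {n} J.
Arguments right_orbits R F {n} J.

(* Main.v *)
Require Import Defs.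
From mathcomp Require Import all_boot all_order all_algebra.
From mathcomp Require Import boolp classical_sets functions reals.
From mathcomp Require Import zify.

(** The theorem is a column reduction.  Under [theta], every linear character
    of V_J is a bracket [A] for exactly one A ([bracket_surj], [bracket_inj]):
    a character chi of the additive group of the field that differed from all
    characters x |-> theta (a * x) would be orthogonal to each of them, and
    then Fourier inversion gives chi = 0 ([charF_theta]).

    As J is column closed, U_J is a group, and the orbit of [A] consists of
    the [proj (A (E + C)^t)] with C in V_J ([right_orbit_bracketE]).  Passing
    from A to such a matrix means adding to each column j of A a combination
    of the columns k > j, truncated to the positions in J.

    Each orbit contains a template ([template_exists]): treat the columns k
    from right to left, subtracting multiples of column k from the columns on
    its left to clear the row of its topmost entry.  This leaves the rows
    cleared earlier intact, because column k itself vanishes in those rows.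

    Two templates A and B in one orbit are equal ([template_unique]): if they
    agree in the columns right of j, their j-th columns differ by a truncated
    combination of the columns k > j of A.  Only those columns k matter whose
    topmost row lies above the diagonal position of column j; both j-th
    columns vanish in that row, and so does every column k' < k of A.  Hence,
    by descending induction on k, each column k contributes nothing. *)

Set Implicit Arguments.
Unset Strict Implicit.
Unset Printing Implicit Defensive.

Import Order.TTheory GRing.Theory Num.Theory.
Local Open Scope classical_set_scope.
Local Open Scope ring_scope.

(** * Linear characters *)

Section LinearChar.
Variables (R : realType) (G : zmodType) (chi : G -> R[i]).
Hypothesis chi_lin : linear_char chi.

Lemma linear_char0 : chi 0 = 1.
Proof.
case: chi_lin => nz chiD; apply: (mulfI (nz 0)).
by rewrite -chiD addr0 mulr1.
Qed.

Lemma linear_charN x : chi (- x) = (chi x)^-1.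
Proof.
case: chi_lin => nz chiD; apply: (mulfI (nz x)).
by rewrite -chiD subrr divff ?linear_char0.
Qed.

Lemma linear_char_sum (I : Type) (r : seq I) (P : pred I) (f : I -> G) :
  chi (\sum_(i <- r | P i) f i) = \prod_(i <- r | P i) chi (f i).
Proof.
case: chi_lin => _ chiD.
by apply: (big_morph chi) => //; exact: linear_char0.
Qed.

End LinearChar.

Section FieldChar.
Variables (R : realType) (F : finFieldType).
Implicit Types chi theta : F -> R[i].

Lemma sum_nontrivial_char chi : nontrivial_char chi -> \sum_x chi x = 0.
Proof.
move=> [[_ chiD] [y chiy]]; set S := \sum_x _.
have SE : S = chi y * S.
  rewrite {1}/S (reindex_inj (addrI y)) mulr_sumr.
  by apply: eq_bigr => x _; rewrite chiD.
apply/eqP; have: (1 - chi y) * S == 0 by rewrite mulrBl mul1r -SE subrr.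
by rewrite mulf_eq0 subr_eq0 eq_sym (negPf chiy).
Qed.

Lemma sum_theta_mul theta (b : F) : nontrivial_char theta ->
  \sum_a theta (a * b) = if b == 0 then #|F|%:R else 0.
Proof.
move=> th; case: (eqVneq b 0) => [->|b0].
  under eq_bigr => a _ do rewrite mulr0 (linear_char0 th.1).
  by rewrite sumr_const.
by rewrite -[RHS](sum_nontrivial_char th) [RHS](reindex_inj (mulIf b0)).
Qed.

(** Duality: the characters of the additive group of a finite field are the
    multiplicative translates of any nontrivial one. *)
Lemma charF_theta theta chi : nontrivial_char theta -> linear_char chi ->
  exists a, forall x, chi x = theta (a * x).
Proof.
move=> th lin; have [thlin _] := th; apply: contrapT => no.
have orth a : \sum_x chi x * theta (a * - x) = 0.
  apply: sum_nontrivial_char; split; first split=> [x|x y].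
  - by rewrite mulf_neq0 ?lin.1 ?thlin.1.
  - by rewrite lin.2 opprD mulrDr thlin.2 mulrACA.
  apply: contrapT => triv; apply: no; exists a => x; apply/eqP.
  apply: contrapT => /negP ne; apply: triv; exists x.
  rewrite mulrN (linear_charN thlin).
  by rewrite -(inj_eq (mulIf (thlin.1 (a * x)))) mulfVK ?thlin.1 ?mul1r.
(* Fourier inversion at 0: the double sum is #|F| * chi 0. *)
have: \sum_a \sum_x chi x * theta (a * - x) = 0 by rewrite big1.
rewrite exchange_big /= (bigD1 0) //= [X in _ + X]big1 => [|x x0].
  rewrite -mulr_sumr sum_theta_mul // oppr0 eqxx (linear_char0 lin) mul1r addr0.
  move=> /eqP; rewrite pnatr_eq0 => /eqP cF.
  by have := fintype0 (0 : F) => /(_ cF).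
by rewrite -mulr_sumr sum_theta_mul // oppr_eq0 (negPf x0) mulr0.
Qed.

Lemma theta_mul_inj theta (a b : F) : nontrivial_char theta ->
  (forall x, theta (a * x) = theta (b * x)) -> a = b.
Proof.
move=> [lin [y thy]] eqab; apply/eqP; rewrite -subr_eq0; apply/negPn/negP => nz.
move: thy; rewrite -[y](mulVKf nz) mulrBl lin.2 linear_charN // eqab.
by rewrite divff ?eqxx ?lin.1.
Qed.

End FieldChar.

(** * Brackets and the dual of V_J *)

Section Brackets.
Variables (R : realType) (F : finFieldType) (n : nat) (J : {set 'I_n * 'I_n}).
Variable theta : F -> R[i].
Hypothesis theta_nt : nontrivial_char theta.
Implicit Types A B C : V F J.

Let theta_lin : linear_char theta := theta_nt.1.

Lemma V_out A i j : (i, j) \notin J -> V_val A i j = 0.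
Proof. by have /supportedP := valP A; apply. Qed.

Lemma V_nz A i j : V_val A i j != 0 -> (i, j) \in J.
Proof. by apply: contraNT => /V_out ->. Qed.

Lemma projE (M : 'M[F]_n) i j :
  V_val (proj J M) i j = if (i, j) \in J then M i j else 0.
Proof. by rewrite mxE. Qed.

Lemma V_eqP A B : (forall i j, (i, j) \in J -> V_val A i j = V_val B i j) ->
  A = B.
Proof.
move=> eqAB; apply: val_inj; apply/matrixP => i j /=.
by have [/eqAB //|ij] := boolP ((i, j) \in J); rewrite !V_out.
Qed.

Lemma V_valD A B : V_val (A + B) = V_val A + V_val B.
Proof. by []. Qed.

Lemma V_valN A : V_val (- A) = - V_val A.
Proof. by []. Qed.

Lemma bracket_lin A : linear_char (bracket theta A).
Proof.
split=> [B|B C]; first exact: theta_lin.1.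
rewrite /bracket -theta_lin.2 -big_split /=; congr theta.
by apply: eq_bigr => ij _; rewrite mxE mulrDr.
Qed.

(** The vector with entry [x] at position [ij] and zeros elsewhere; it is zero
    when [ij] lies outside [J]. *)
Definition Vdelta (ij : 'I_n * 'I_n) (x : F) : V F J :=
  proj J (x *: delta_mx ij.1 ij.2).

Lemma VdeltaE ij x i j : (i, j) \in J ->
  V_val (Vdelta ij x) i j = if (i, j) == ij then x else 0.
Proof.
case: ij => a b ijJ; rewrite projE ijJ !mxE /= xpair_eqE.
by case: ifP; rewrite ?mulr1 ?mulr0.
Qed.

Lemma V_decomp A : A = \sum_(ij in J) Vdelta ij (V_val A ij.1 ij.2).
Proof.
apply: V_eqP => i j ijJ; rewrite (big_morph (@V_val F n J) V_valD (erefl _)).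
rewrite summxE (bigD1 (i, j)) // VdeltaE // eqxx big1 => [|kl /andP[_ ne]].
  by rewrite /= addr0.
by rewrite VdeltaE // eq_sym (negPf ne).
Qed.

Lemma bracket_Vdelta A ij x : ij \in J ->
  bracket theta A (Vdelta ij x) = theta (V_val A ij.1 ij.2 * x).
Proof.
move=> ijJ; rewrite /bracket (bigD1 ij) // big1 => [|[k l] /andP[klJ ne]].
  by case: ij ijJ => i j ijJ; rewrite VdeltaE // eqxx /= addr0.
by rewrite VdeltaE // (negPf ne) mulr0.
Qed.

Lemma bracket_inj A B : bracket theta A = bracket theta B -> A = B.
Proof.
move=> eqAB; apply: V_eqP => i j ijJ; apply: (theta_mul_inj theta_nt) => x.
by rewrite -!(@bracket_Vdelta _ (i, j)) // eqAB.
Qed.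

Lemma bracket_surj chi : hatV R F J chi -> exists A, chi = bracket theta A.
Proof.
move=> lin; have ex ij : exists a, forall x, chi (Vdelta ij x) = theta (a * x).
  apply: charF_theta theta_nt _; split=> [x|x y]; first exact: lin.1.
  rewrite -lin.2; congr chi; apply: V_eqP => i j ijJ.
  by rewrite V_valD [RHS]mxE !VdeltaE //; case: ifP; rewrite ?addr0.
have [a aP] := choice ex.
exists (proj J (\matrix_(i, j) a (i, j))); apply/funext => B.
rewrite {1}(V_decomp B) (linear_char_sum lin) /bracket (linear_char_sum theta_lin).
by apply: eq_bigr => -[i j] ijJ; rewrite aP projE ijJ mxE.
Qed.

Lemma char_act_bracket A (u : 'M[F]_n) :
  char_act (bracket theta A) u = bracket theta (proj J (A *m (invmx u)^T)).
Proof.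
apply/funext => B; rewrite /char_act /bracket; congr theta.
set v := invmx u.
(* Both sums over J are traces, by the supports of A and of B. *)
have tr (M N : 'M[F]_n) : \tr (M *m N^T) = \sum_(ij : 'I_n * 'I_n) M ij.1 ij.2 * N ij.1 ij.2.
  rewrite /mxtrace -(pair_bigA _ (fun i j => M i j * N i j)) /=; apply: eq_bigr => i _.
  by rewrite mxE; apply: eq_bigr => j _; rewrite mxE.
transitivity (\tr (V_val A *m (V_val B *m v)^T)).
  rewrite tr [RHS](bigID (mem J)) /= [X in _ = _ + X]big1 ?addr0 => [|[i j] ij].
    by apply: eq_bigr => -[i j] ij; rewrite projE ij.
  by rewrite V_out ?mul0r.
rewrite trmx_mul mulmxA tr (bigID (mem J)) /= [X in _ + X = _]big1 ?addr0 => [|[i j] ij].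
  by apply: eq_bigr => -[i j] ij; rewrite projE ij.
by rewrite (V_out B) ?mulr0.
Qed.

End Brackets.

(** * The group U_J and its orbits *)

Section Orbits.
Variables (R : realType) (F : finFieldType) (n : nat) (J : {set 'I_n * 'I_n}).
Hypothesis Jcc : column_closed J.
Implicit Types (A B C : V F J) (u v : 'M[F]_n).

Lemma column_closed_lt i j : (i, j) \in J -> (i < j)%N.
Proof. by case: Jcc => I ->; rewrite !inE => /andP[]. Qed.

Lemma column_closed_col (i j k : 'I_n) : (i, j) \in J -> (k < j)%N -> (k, j) \in J.
Proof. by case: Jcc => I ->; rewrite !inE /= => /andP[_ ->] ->. Qed.

Lemma U_unit u : U F J u -> u \in unitmx.
Proof.
move=> [A _ <-]; rewrite -unitmx_tr unitmxE det_trig.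
  rewrite big1 ?unitr1 // => i _; rewrite !mxE eqxx V_out ?addr0 //.
  by apply/negP => /column_closed_lt; rewrite ltnn.
apply/is_trig_mxP => i j ltij; rewrite !mxE V_out ?addr0.
  by case: eqP ltij => // ->; rewrite ltnn.
by apply/negP => /column_closed_lt; rewrite ltnNge (ltnW ltij).
Qed.

Lemma U1 : U F J 1%:M.
Proof. by exists 0 => //=; rewrite addr0. Qed.

Lemma U_inv u : U F J u -> U F J (invmx u).
Proof.
move=> Uu; have uu := U_unit Uu; have [A _ defu] := Uu.
exists (- proj J (A *m invmx u)) => //.
rewrite V_valN proj_mulmx_invmx //.
have -> : V_val A = u - 1%:M by rewrite -defu addrAC subrr add0r.
by rewrite mulmxBl mulmxV // mul1mx opprB addrC subrK.
Qed.

Lemma U_mul u v : U F J u -> U F J v -> U F J (u *m v).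
Proof.
move=> [A _ <-] Uv; have [B _ defv] := Uv.
exists (B + proj J (A *m v)) => //.
have -> : V_val (B + proj J (A *m v)) = V_val B + V_val A *m v.
  rewrite V_valD -{1}[v]invmxK proj_mulmx_invmx ?invmxK //; exact: U_inv.
by rewrite addrA defv mulmxDl mul1mx.
Qed.

Implicit Type chi : V F J -> R[i].

Lemma char_act1 chi : char_act chi 1%:M = chi.
Proof.
apply/funext => B; rewrite /char_act invmx1 mulmx1; congr chi.
by apply: val_inj; rewrite [LHS]proj_id //; exact: (valP B).
Qed.

Lemma char_actM chi u v : U F J u -> U F J v ->
  char_act (char_act chi u) v = char_act chi (u *m v).
Proof.
move=> Uu Uv; apply/funext => B; rewrite /char_act proj_mulmx_invmx //.
have -> : invmx (u *m v) = invmx v *m invmx u.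
  have uv := U_unit (U_mul Uu Uv).
  apply: (can_inj (mulKmx uv)); rewrite mulmxV // mulmxA mulmxK ?mulmxV //.
  - exact: U_unit.
  - exact: U_unit.
by rewrite mulmxA.
Qed.

Lemma right_orbit_refl chi : right_orbit chi chi.
Proof. by exists 1%:M; [exact: U1|exact: char_act1]. Qed.

Lemma right_orbit_trans chi1 chi2 chi3 :
  right_orbit chi1 chi2 -> right_orbit chi2 chi3 -> right_orbit chi1 chi3.
Proof.
move=> [u Uu <-] [v Uv <-]; exists (u *m v); first exact: U_mul.
by rewrite char_actM.
Qed.

Lemma right_orbit_sym chi1 chi2 : right_orbit chi1 chi2 -> right_orbit chi2 chi1.
Proof.
move=> [u Uu <-]; exists (invmx u); first exact: U_inv.
by rewrite char_actM ?mulmxV ?char_act1 //; [exact: U_unit|exact: U_inv].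
Qed.

Lemma right_orbit_eq chi1 chi2 :
  right_orbit chi1 chi2 -> right_orbit chi1 = right_orbit chi2.
Proof.
move=> o12; apply/seteqP; split=> chi; apply: right_orbit_trans => //.
exact: right_orbit_sym.
Qed.

(** [E + C] ranges over the inverses of the elements of U_J. *)
Lemma right_orbit_bracketE (theta : F -> R[i]) A chi :
  right_orbit (bracket theta A) chi <->
  exists C, chi = bracket theta (proj J (A *m (1%:M + V_val C)^T)).
Proof.
split=> [[u Uu <-]|[C ->]].
  have [C _ defC] := U_inv Uu; exists C.
  by rewrite char_act_bracket defC.
have UC : U F J (1%:M + V_val C) by exists C.
exists (invmx (1%:M + V_val C)); first exact: U_inv.
by rewrite char_act_bracket invmxK.
Qed.

Lemma proj_addE A C i j : (i, j) \in J ->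
  V_val (proj J (A *m (1%:M + V_val C)^T)) i j =
  V_val A i j + \sum_k V_val A i k * V_val C j k.
Proof.
move=> ijJ; rewrite projE ijJ linearD /= trmx1 mulmxDr mulmx1 mxE; congr (_ + _).
by rewrite mxE; apply: eq_bigr => k _; rewrite mxE.
Qed.

(** * Templates *)

Lemma topmost_exists (M : 'M[F]_n) i j : M i j != 0 ->
  exists2 k : 'I_n, (k <= i)%N & topmost_nonzero M k j.
Proof.
move=> nz; case: (@arg_minnP _ i (fun k => M k j != 0) (@nat_of_ord n) nz).
move=> k nzk kmin; exists k; first exact: kmin.
split=> // l ltlk; apply/eqP; apply: contraLR ltlk => /kmin.
by rewrite -leqNgt.
Qed.

(** The template condition restricted to the columns from [m] on. *)
Definition template_from (m : nat) A := forall i j : 'I_n, (m <= j)%N ->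
  topmost_nonzero (V_val A) i j ->
  forall l : 'I_n, (l < j)%N -> (i, l) \in J -> V_val A i l = 0.

Lemma template_zero A i (j l : 'I_n) : is_template A ->
  topmost_nonzero (V_val A) i j -> (l < j)%N -> V_val A i l = 0.
Proof.
move=> tA top lj; have [|/V_out //] := boolP ((i, l) \in J).
exact: tA top _ lj.
Qed.

(** Clearing, to the left of column [k], the row of the topmost entry of that
    column; nothing has to be done if column [k] is zero or does not exist. *)
Lemma template_step A k : template_from k.+1 A ->
  exists C, template_from k (proj J (A *m (1%:M + V_val C)^T)).
Proof.
move=> tA.
have [[i [k' kk' top]]|no] :=
  pselect (exists i, exists2 k' : 'I_n, k' = k :> nat & topmost_nonzero (V_val A) i k').
  subst k; have [nz topz] := top; have ikJ := V_nz nz.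
  (* C has its only nonzero column at k', with the multipliers of column k'. *)
  pose C := proj J (\matrix_(l, c)
    (if c == k' then - V_val A i l / V_val A i k' else 0) : 'M[F]_n).
  exists C; set B := proj J _.
  have Br r (c : 'I_n) : (k' <= c)%N -> V_val B r c = V_val A r c.
    move=> kc; have [rcJ|rc] := boolP ((r, c) \in J); last by rewrite !V_out.
    rewrite proj_addE // big1 ?addr0 // => d _; rewrite projE mxE.
    case: ifP => [/column_closed_lt cd|]; last by rewrite mulr0.
    by case: eqP => [dk|]; rewrite ?mulr0 //; move: cd; rewrite dk ltnNge kc.
  have Bl r (c : 'I_n) : (c < k')%N -> (r, c) \in J ->
      V_val B r c = V_val A r c - V_val A r k' * (V_val A i c / V_val A i k').
    move=> ck rcJ; rewrite proj_addE //; congr (_ + _).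
    rewrite (bigD1 k') //= big1 ?addr0 => [|d dk].
      by rewrite projE mxE eqxx (column_closed_col ikJ ck) mulNr mulrN.
    by rewrite projE mxE (negPf dk) if_same mulr0.
  move=> r c kc [nzB topB] l lc rlJ.
  rewrite Br // in nzB.
  have topA : topmost_nonzero (V_val A) r c.
    by split=> // d dr; rewrite -Br // topB.
  have [ltlk|lekl] := ltnP l k'; last first.
    by rewrite Br //; apply: (tA r c) => //; exact: leq_ltn_trans lekl lc.
  rewrite Bl //; move: kc; rewrite leq_eqVlt => /orP[/eqP kc|kc].
    have ck : c = k' by apply: val_inj; rewrite /= -kc.
    have -> : r = i.
      rewrite ck in topA; case: topA => nzr topr; apply: val_inj => /=.
      by case: (ltngtP r i) => // [/topz|/topr] z; rewrite z eqxx in nz nzr.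
    by rewrite mulrC mulfVK // subrr.
  have -> : V_val A r k' = 0.
    have [rkJ|/V_out //] := boolP ((r, k') \in J).
    exact: (tA r c).
  by rewrite mul0r subr0; apply: (tA r c).
exists 0; have -> : proj J (A *m (1%:M + V_val (0 : V F J))^T) = A.
  apply: V_eqP => i j ijJ; rewrite proj_addE // big1 ?addr0 // => l _.
  by rewrite mxE mulr0.
move=> i j; rewrite leq_eqVlt => /orP[/eqP kj top|]; last exact: tA.
by case: no; exists i; exists j.
Qed.

Lemma template_exists (theta : F -> R[i]) A :
  exists2 B, right_orbit (bracket theta A) (bracket theta B) & is_template B.
Proof.
suff ex m : exists2 B, right_orbit (bracket theta A) (bracket theta B)
    & template_from (n - m) B.
  have [B oB tB] := ex n; exists B => // i j.
  by apply: tB; rewrite subnn.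
elim: m => [|m [B oB tB]].
  exists A; first exact: right_orbit_refl.
  by move=> i j; rewrite subn0 leqNgt ltn_ord.
have [lenm|ltmn] := leqP n m.
  by exists B => //; move: tB; have -> : (n - m.+1 = n - m)%N by lia.
have [|C tC] := @template_step B (n - m.+1); first by rewrite subnSK.
exists (proj J (B *m (1%:M + V_val C)^T)) => //.
by apply: right_orbit_trans oB _; apply/right_orbit_bracketE; exists C.
Qed.

Lemma template_unique A C : is_template A ->
  is_template (proj J (A *m (1%:M + V_val C)^T)) ->
  proj J (A *m (1%:M + V_val C)^T) = A.
Proof.
set B := proj J _ => tA tB.
(* Descending induction on the column j, as an induction on a bound d of n - j. *)
suff eqcol d : forall i j : 'I_n, (n - j <= d)%N -> V_val B i j = V_val A i j.
  by apply: V_eqP => i j _; exact: (eqcol _ _ _ (leqnn _)).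
elim: d => [|d IHd] i j jd; first by have := ltn_ord j; lia.
have [ijJ|ijJ] := boolP ((i, j) \in J); last by rewrite !V_out.
have IHcol r (k : 'I_n) : (j < k)%N -> V_val B r k = V_val A r k.
  by move=> jk; apply: IHd; have := ltn_ord k; lia.
(* Descending induction on k, with a bound e of n - k: column k does not
   contribute to the rows r < j, the only ones of column j inside J. *)
suff contrib e : forall r k : 'I_n, (n - k <= e)%N -> (r < j)%N ->
    V_val A r k * V_val C j k = 0.
  rewrite proj_addE // big1 ?addr0 // => k _.
  exact: contrib (leqnn _) (column_closed_lt ijJ).
elim: e => [|e IHe] r k ke rj; first by have := ltn_ord k; lia.
have [jkJ|/V_out ->] := boolP ((j, k) \in J); last by rewrite mulr0.
have jk := column_closed_lt jkJ.
case: (eqVneq (V_val A r k) 0) => [->|nz]; first by rewrite mul0r.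
have [t tr topA] := topmost_exists nz.
have tj : (t < j)%N by exact: leq_ltn_trans tr rj.
have topB : topmost_nonzero (V_val B) t k.
  by case: topA => nzt topt; split=> [|s st]; rewrite IHcol // topt.
(* Compare the j-th columns of A and B in the topmost row t of column k. *)
have := proj_addE A C (column_closed_col ijJ tj).
rewrite -/B (template_zero tB topB jk) (template_zero tA topA jk) add0r.
rewrite (bigD1 k) //= big1 => [/esym/eqP|l lk].
  by rewrite addr0 mulf_eq0 (negPf topA.1) => /eqP ->; rewrite mulr0.
have [ltlk|lekl] := ltnP l k; first by rewrite (template_zero tA topA) ?mul0r.
apply: IHe tj; have kl : (k < l)%N by rewrite ltn_neqAle eq_sym lk.
by have := ltn_ord l; lia.
Qed.

End Orbits.

Theorem corollary4p18 (R : realType) (F : finFieldType) (n : nat)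
    (theta : F -> R[i]) (J : {set 'I_n * 'I_n}) :
  nontrivial_char theta -> column_closed J ->
  (forall O : set (V F J -> R[i]), right_orbits R F J O ->
     exists! chi : V F J -> R[i], O chi /\ templates theta chi) /\
  set_bij (templates theta) (right_orbits R F J) (@right_orbit R F n J).
Proof.
move=> theta_nt Jcc.
have ex chi : hatV R F J chi ->
    exists2 chi', right_orbit chi chi' & templates theta chi'.
  move=> /(bracket_surj theta_nt)[A ->].
  have [B oB tB] := template_exists Jcc theta A.
  by exists (bracket theta B) => //; exists B.
have uniq (chi1 chi2 : V F J -> R[i]) : templates theta chi1 -> templates theta chi2 ->
    right_orbit chi1 chi2 -> chi1 = chi2.
  move=> [A tA <-] [B tB <-] /(right_orbit_bracketE Jcc)[C].
  move=> /(bracket_inj theta_nt) defB; move: tB; rewrite defB => tB.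
  by rewrite template_unique.
split=> [O [chi hchi <-]|].
  have [chi' o' t'] := ex _ hchi; exists chi'; split=> // chi'' [o'' t''].
  apply: uniq => //; apply: (right_orbit_trans Jcc) o''.
  exact: right_orbit_sym.
split=> [chi [A _ <-]|chi1 chi2 /set_mem t1 /set_mem t2 eqo|O [chi hchi <-]].
- by exists (bracket theta A) => //; apply: bracket_lin.
- by apply: uniq => //; rewrite eqo; exact: right_orbit_refl.
- have [chi' o' t'] := ex _ hchi; exists chi' => //.
  exact/esym/right_orbit_eq.
Qed.
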